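(* Let $k$ be a commutative ring, let $T$ be a finite lattice, let $(E,R)=\mathrm{Irr}(T)$, and let $G^c=\{a\in T\mid a\notin E,\ a<r^\infty(\sigma^\infty(a))\}$ be the complement of $G=G(T)$ in $T$. Let $u_T\in k(T^T)$ denote the composition of all the elements $u_a$, for $a\in G^c$, in some order. (a) Let $X$ be a finite set. Then for any map $\varphi:X\to T$, the element $u_T\circ\varphi\in k(T^X)$ is a $k$-linear combination of functions $f:X\to T$ such that $f(X)\subseteq G$. (b) Let $\mathcal{B}_X$ be the set of all maps $\varphi:X\to T$ such that $E\subseteq\varphi(X)\subseteq G$. Then the set $\Theta_{T,X}(\mathcal{B}_X)$ generates $\mathbb{S}_{E,R^{op}}(X)$ as a $k$-module.
   Context: **Lattices.** In a finite lattice $T$ (least element $\hat0$, greatest element $\hat1$), an element $e$ is irreducible if $e=\bigvee_{a\in A}a$ with $A\subseteq T$ implies $e\in A$ (so $\hat0$ is not irreducible). $\mathrm{Irr}(T)=(E,R)$ denotes the set $E$ of irreducible elements with the order $R$ induced from $T$; $R^{op}$ is the opposite order. For $t\in T$: $r(t)$ is the join of all elements strictly smaller than $t$, and $r^\infty(t)$ is the stable value of the iterates $r^n(t)$; $\sigma(t)$ is the meet of all irreducible elements strictly larger than $t$ (empty meet $=\hat1$), and $\sigma^\infty(t)$ is the stable value of the iterates $\sigma^n(t)$. $G=G(T)=E\sqcup\{a\in T\mid a=r^\infty(\sigma^\infty(a))\}$. **The elements $u_a$.** For $a\in G^c$, with $b=r^\infty(\sigma^\infty(a))$, there is a unique integer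 $r\geq0$ such that $a<\sigma(a)<\dots<\sigma^r(a)<b\leq\sigma^{r+1}(a)$; put $(a_0,\dots,a_{r+1})=(a,\sigma(a),\dots,\sigma^r(a),b)$. For distinct elements $c_0,\dots,c_n$ of $T$ ($n\geq1$), $[c_0,\dots,c_n]:T\to T$ is the map sending $c_j$ to $c_{j+1}$ for $0\leq j\leq n-1$ and fixing every other element. Then $u_a=[a_0,a_1]-[a_0,a_1,a_2]+\dots+(-1)^r[a_0,a_1,\dots,a_{r+1}]\in k(T^T)$, where $k(Y)$ denotes the free $k$-module on a set $Y$. Composition of maps $T^T\times T^T\to T^T$ and $T^T\times T^X\to T^X$ is extended bilinearly. (An empty composition is the identity.) **Correspondences.** $\mathcal{C}(Y,X)$ is the set of all subsets of $Y\times X$; $SQ=\{(z,x)\mid\exists y\in Y,\ (z,y)\in S,\ (y,x)\in Q\}$ for $S\subseteq Z\times Y$, $Q\subseteq Y\times X$; $k\mathcal{C}(Y,X)$ is its $k$-linearization with bilinear composition. $\Delta_E=\{(e,e)\mid e\in E\}$, $\Delta_\alpha=\{(\alpha(e),e)\mid e\in E\}$ for a permutation $\alpha$ of $E$. **Fundamental functors and $\Theta$.** For a finite poset $(E,R)$, $\mathcal{P}_Ef_R$ is the left $k\mathcal{C}(E,E)$-module with $k$-basis $\{\Delta_\alpha f_R\}$, $\alpha$ running over the permutations of $E$ ($f_R:=\Delta_{\mathrm{id}}f_R$), where a relation $Q\in\mathcal{C}(E,E)$ acts by $Q\cdot\Delta_\alpha f_R=\Delta_{\beta\alpha}f_R$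 if there is a (necessarily unique) permutation $\beta$ with $\Delta_E\subseteq\Delta_{\beta^{-1}}Q\subseteq\{(\alpha(e),\alpha(f))\mid(e,f)\in R\}$, and by $0$ otherwise. For a left $k\mathcal{C}(E,E)$-module $W$, $L_{E,W}(X)=k\mathcal{C}(X,E)\otimes_{k\mathcal{C}(E,E)}W$ and $J_{E,W}(X)=\{\sum_i\varphi_i\otimes w_i\mid\forall\rho\in k\mathcal{C}(E,X),\ \sum_i(\rho\varphi_i)\cdot w_i=0\}$. The fundamental functor is $\mathbb{S}_{E,R}=L_{E,\mathcal{P}_Ef_R}/J_{E,\mathcal{P}_Ef_R}$. $F_T(X)=k(T^X)$, and $\Theta_{T,X}:F_T(X)\to\mathbb{S}_{E,R^{op}}(X)$ is the $k$-linear (surjective) map sending $\varphi:X\to T$ to the class of $\Gamma_\varphi\otimes f_{R^{op}}$, where $\Gamma_\varphi=\{(x,e)\in X\times E\mid e\leq\varphi(x)\}$. *)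

(* Defs.v *)
From HB Require Import structures.
From mathcomp Require Import all_boot all_order all_algebra all_fingroup.
From mathcomp Require Import finmap generic_quotient ring_quotient.
From mathcomp Require Import boolp.
From mathcomp Require Import monalg.

Set Implicit Arguments.
Unset Strict Implicit.
Unset Printing Implicit Defensive.

Import Order.TTheory GRing.Theory.
Local Open Scope ring_scope.
Local Open Scope quotient_scope.

Section Span.
Variables (k : pzRingType) (V : lmodType k) (P : V -> Prop).

Definition lspan : {pred V} := fun v =>
  `[< exists l : seq (k * V),
        (forall p, p \in l -> P p.2) /\ v = \sum_(p <- l) p.1 *: p.2 >].

Fact lspan_submod : subsemimod_closed lspan.
Proof.
split; first split.
- by apply/asboolP; exists [::]; rewrite big_nil.
- move=> u v /asboolP [l [Pl ->]] /asboolP [m [Pm ->]].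
  apply/asboolP; exists (l ++ m); rewrite big_cat; split=> // p.
  by rewrite mem_cat => /orP [/Pl|/Pm].
- move=> c u /asboolP [l [Pl ->]]; apply/asboolP.
  exists [seq (c * p.1, p.2) | p <- l]; split.
    by move=> p /mapP [q /Pl Pq ->].
  by rewrite big_map scaler_sumr; apply: eq_bigr => p _; rewrite scalerA.
Qed.
HB.instance Definition _ := GRing.isSubmodClosed.Build k V lspan lspan_submod.

End Span.

Section LmodQuotient.
Variables (k : pzRingType) (V : lmodType k) (S : submodClosed V).

(* submodClosed has closure under opposites only implicitly, whereas
   Quotient.quot expects a zmodClosed. *)
Definition lsub : {pred V} := fun v => v \in S.
Fact lsub_zmod : zmod_closed lsub.
Proof.
split=> [|u v uS vS]; rewrite unfold_in ?rpred0 //.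
by rewrite -scaleN1r rpredD // rpredZ.
Qed.
HB.instance Definition _ := GRing.isZmodClosed.Build V lsub lsub_zmod.

Definition lquot := Quotient.quot lsub.
HB.instance Definition _ := Choice.on lquot.
HB.instance Definition _ := GRing.Zmodule.on lquot.

Definition lpi (v : V) : lquot := \pi_(Quotient.quot lsub) v.
Definition lscale (c : k) (x : lquot) : lquot := lpi (c *: repr (x : Quotient.quot lsub)).

Lemma lpi_eq (u v : V) : (lpi u == lpi v) = (u - v \in S).
Proof. exact/esym/(Quotient.idealrBE lsub). Qed.

Lemma lpiD : {morph lpi : u v / u + v}.
Proof. by move=> u v; rewrite /lpi raddfD. Qed.

Lemma lpiZ c v : lpi (c *: v) = lscale c (lpi v).
Proof.
apply/eqP; rewrite lpi_eq -scalerBr rpredZ // -lpi_eq.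
by rewrite /lpi reprK.
Qed.

Lemma lpi_repr x : lpi (repr (x : Quotient.quot lsub)) = x.
Proof. exact: reprK. Qed.

Fact lscaleA c e x : lscale c (lscale e x) = lscale (c * e) x.
Proof. by rewrite -(lpi_repr x) -!lpiZ scalerA. Qed.
Fact lscale1 : left_id 1 lscale.
Proof. by move=> x; rewrite -(lpi_repr x) -!lpiZ scale1r. Qed.
Fact lscaleDr : right_distributive lscale +%R.
Proof.
by move=> c x y; rewrite -(lpi_repr x) -(lpi_repr y) -!(lpiD, lpiZ) scalerDr.
Qed.
Fact lscaleDl x : {morph lscale^~ x : c e / c + e}.
Proof. by move=> c e; rewrite -(lpi_repr x) -!lpiZ scalerDl lpiD. Qed.
HB.instance Definition _ :=
  GRing.Zmodule_isLmodule.Build k lquot lscaleA lscale1 lscaleDr lscaleDl.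

Fact lpi_linear : linear lpi.
Proof. by move=> c u v; rewrite lpiD lpiZ. Qed.
HB.instance Definition _ := GRing.isLinear.Build k V lquot *:%R lpi lpi_linear.

End LmodQuotient.

(* The library only makes malg a module over nonzero rings. *)
Section FreeModule.
Variables (k : pzRingType) (K : choiceType).

Definition free_mod := {malg k[K]}.
HB.instance Definition _ := GRing.Zmodule.on free_mod.

Definition fm_scale (c : k) (g : free_mod) : free_mod :=
  [malg y in msupp g => c * g@_y].

Fact fm_scaleE c (g : free_mod) y : (fm_scale c g)@_y = c * g@_y.
Proof. by rewrite mcoeffE; case: msuppP; rewrite ?mulr0. Qed.
Fact fm_scaleA c e g : fm_scale c (fm_scale e g) = fm_scale (c * e) g.
Proof. by apply/malgP=> y; rewrite !fm_scaleE mulrA. Qed.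
Fact fm_scale1 : left_id 1 fm_scale.
Proof. by move=> g; apply/malgP=> y; rewrite fm_scaleE mul1r. Qed.
Fact fm_scaleDr : right_distributive fm_scale +%R.
Proof.
by move=> c g h; apply/malgP=> y; rewrite mcoeffD !fm_scaleE mcoeffD mulrDr.
Qed.
Fact fm_scaleDl g : {morph fm_scale^~ g : c e / c + e}.
Proof. by move=> c e; apply/malgP=> y; rewrite mcoeffD !fm_scaleE mulrDl. Qed.
HB.instance Definition _ := GRing.Zmodule_isLmodule.Build k free_mod
  fm_scaleA fm_scale1 fm_scaleDr fm_scaleDl.

Definition fm_gen (y : K) : free_mod := << 1 *g y >>.
End FreeModule.

(* M (x)_A N, for modules M and N over k and a k-algebra A acting on the right
   of M through ract and on the left of N through lact. *)
Section Tensor.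
Variables (k : pzRingType) (M N : lmodType k) (A : Type).
Variables (ract : M -> A -> M) (lact : A -> N -> N).

Local Notation gen m n := (fm_gen k (m, n)).

Inductive tensor_rel : free_mod k (M * N)%type -> Prop :=
| TensorDl m1 m2 n : tensor_rel (gen (m1 + m2) n - (gen m1 n + gen m2 n))
| TensorDr m n1 n2 : tensor_rel (gen m (n1 + n2) - (gen m n1 + gen m n2))
| TensorZl c m n : tensor_rel (gen (c *: m) n - c *: gen m n)
| TensorZr c m n : tensor_rel (gen m (c *: n) - c *: gen m n)
| TensorA m a n : tensor_rel (gen (ract m a) n - gen m (lact a n)).

Definition tensor := lquot (lspan tensor_rel).
HB.instance Definition _ := GRing.Lmodule.on tensor.

Definition tens (m : M) (n : N) : tensor := lpi (lspan tensor_rel) (gen m n).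

Lemma tensZr c m n : c *: tens m n = tens m (c *: n).
Proof.
rewrite /tens; apply/esym/eqP; rewrite -linearZ lpi_eq.
apply/asboolP; exists [:: (1, gen m (c *: n) - c *: gen m n)].
by rewrite big_seq1 scale1r; split=> // p; rewrite inE => /eqP ->; exact: TensorZr.
Qed.
End Tensor.

Section FiniteFreeModule.
Variable k : comPzRingType.

(* k(Y) for finite Y; ^o is only there to select the module structure. *)
Definition kfree (Y : finType) := {ffun Y -> k^o}.
HB.instance Definition _ Y := GRing.Lmodule.on (kfree Y).

Definition kbasis (Y : finType) (y : Y) : kfree Y := [ffun z => (z == y)%:R].

Definition bilin_ext (Y1 Y2 : finType) (V : lmodType k) (op : Y1 -> Y2 -> V)
    (u : kfree Y1) (v : kfree Y2) : V :=
  \sum_(y1 : Y1) \sum_(y2 : Y2) (u y1 * v y2) *: op y1 y2.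

Definition map_comp (A B C : finType) (g : {ffun B -> C}) (f : {ffun A -> B}) :
  {ffun A -> C} := [ffun x => g (f x)].

Definition kmap_comp (A B C : finType)
    (u : kfree {ffun B -> C}) (v : kfree {ffun A -> B}) :
    kfree {ffun A -> C} :=
  bilin_ext (fun g f => kbasis (map_comp g f)) u v.

Definition corr (Y X : finType) : finType := {set Y * X}.

Definition corr_comp (Z Y X : finType) (S : corr Z Y) (Q : corr Y X) :
  corr Z X :=
  [set zx | [exists y, ((zx.1, y) \in S) && ((y, zx.2) \in Q)]].

Definition kcorr_comp (Z Y X : finType)
    (u : kfree (corr Z Y)) (v : kfree (corr Y X)) : kfree (corr Z X) :=
  bilin_ext (fun S Q => kbasis (corr_comp S Q)) u v.

End FiniteFreeModule.

Definition diag (E : finType) : corr E E := [set (e, e) | e in E].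

Definition perm_corr (E : finType) (alpha : {perm E}) : corr E E :=
  [set (alpha e, e) | e in E].

Definition op_corr (E : finType) (R : corr E E) : corr E E :=
  [set (p.2, p.1) | p in R].

Section FundamentalModule.
Variables (k : comPzRingType) (E : finType) (R : corr E E).

(* The module P_E f_R: the basis element indexed by alpha is Delta_alpha f_R. *)
Definition fund_mod := kfree k {perm E}.
HB.instance Definition _ := GRing.Lmodule.on fund_mod.

Definition fund_perm (Q : corr E E) (alpha beta : {perm E}) : bool :=
  (diag E \subset corr_comp (perm_corr beta^-1%g) Q) &&
  (corr_comp (perm_corr beta^-1%g) Q \subset
     [set (alpha p.1, alpha p.2) | p in R]).

(* In {perm E} products are read from left to right, so that alpha * beta is
   the composite of beta after alpha. When R is an order, at most one beta
   satisfies the condition: see fund_perm_uniq. *)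
Definition fund_act_basis (Q : corr E E) (alpha : {perm E}) : fund_mod :=
  if [pick beta | fund_perm Q alpha beta] is Some beta
  then kbasis k (alpha * beta)%g else 0.

Lemma mem_perm_corrV (Q : corr E E) (beta : {perm E}) e f :
  ((e, f) \in corr_comp (perm_corr beta^-1%g) Q) = ((beta e, f) \in Q).
Proof.
rewrite inE /=; apply/existsP/idP => [[y /andP [/imsetP [x _ [-> ->]]]]|bQ].
  by rewrite permKV.
by exists (beta e); rewrite bQ andbT; apply/imsetP; exists (beta e); rewrite ?permK.
Qed.

Lemma fund_perm_uniq : (forall e f, (e, f) \in R -> (f, e) \in R -> e = f) ->
  forall Q alpha beta gamma,
    fund_perm Q alpha beta -> fund_perm Q alpha gamma -> beta = gamma.
Proof.
move=> Ra Q alpha.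
have key beta gamma : fund_perm Q alpha beta -> fund_perm Q alpha gamma ->
    forall e, exists x y, [/\ (x, y) \in R, alpha x = (beta^-1)%g (gamma e)
      & alpha y = e].
  move=> /andP [_ /subsetP sb] /andP [/subsetP dg _] e.
  have /dg : (e, e) \in diag E by apply/imsetP; exists e.
  rewrite mem_perm_corrV -{1}(permKV beta (gamma e)) -mem_perm_corrV => /sb.
  by case/imsetP => -[x y] /= Rxy [-> ->]; exists x, y.
move=> beta gamma fb fg; apply/permP => e.
have [x [y [Rxy ax ay]]] := key _ _ fb fg e.
have [x' [y' [Rxy' ax' ay']]] := key _ _ fg fb ((beta^-1)%g (gamma e)).
have y'x : y' = x by apply: (@perm_inj _ alpha); rewrite ax ay'.
have x'y : x' = y by apply: (@perm_inj _ alpha); rewrite ax' ay permKV permK.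
rewrite y'x x'y in Rxy'.
by rewrite -{1}ay -(Ra _ _ Rxy Rxy') ax permKV.
Qed.

Definition fund_act (u : kfree k (corr E E)) (w : fund_mod) : fund_mod :=
  bilin_ext fund_act_basis u w.

Fact fund_act_linear u : linear (fund_act u).
Proof.
move=> c v w; rewrite /fund_act /bilin_ext scaler_sumr -big_split.
apply: eq_bigr => Q _; rewrite scaler_sumr -big_split.
apply: eq_bigr => alpha _; rewrite /= !ffunE scalerA -scalerDl; congr (_ *: _).
by rewrite mulrDr [c *: _]/(c * _) mulrCA.
Qed.
HB.instance Definition _ u :=
  GRing.isLinear.Build k fund_mod fund_mod *:%R (fund_act u)
    (fund_act_linear u).

Definition fund_action (u : kfree k (corr E E)) : {linear fund_mod -> fund_mod} :=
  fund_act u.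

End FundamentalModule.

Section Functors.
Variables (k : comPzRingType) (E : finType) (W : lmodType k).
Variable act : kfree k (corr E E) -> {linear W -> W}.
Variable X : finType.

Definition Lfun : lmodType k :=
  tensor (fun (u : kfree k (corr X E)) (a : kfree k (corr E E)) =>
            kcorr_comp u a)
         (fun a w => act a w).

Definition Ltens (u : kfree k (corr X E)) (w : W) : Lfun := tens _ _ u w.

Definition Jfun : {pred Lfun} := fun t =>
  `[< exists l : seq (kfree k (corr X E) * W),
        t = \sum_(p <- l) Ltens p.1 p.2 /\
        forall rho : kfree k (corr E X),
          \sum_(p <- l) act (kcorr_comp rho p.1) p.2 = 0 >].

Fact Jfun_submod : subsemimod_closed Jfun.
Proof.
split; first split.
- by apply/asboolP; exists [::]; split=> [|rho]; rewrite !big_nil.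
- move=> t1 t2 /asboolP [l1 [-> J1]] /asboolP [l2 [-> J2]].
  apply/asboolP; exists (l1 ++ l2); split=> [|rho]; rewrite !big_cat //=.
  by rewrite J1 J2 addr0.
- move=> c t /asboolP [l [-> Jl]]; apply/asboolP.
  exists [seq (p.1, c *: p.2) | p <- l]; split=> [|rho]; rewrite big_map.
    by rewrite scaler_sumr; apply: eq_bigr => p _; apply: tensZr.
  transitivity (c *: \sum_(p <- l) act (kcorr_comp rho p.1) p.2).
    by rewrite scaler_sumr; apply: eq_bigr => p _; rewrite linearZ.
  by rewrite Jl scaler0.
Qed.
HB.instance Definition _ := GRing.isSubmodClosed.Build k Lfun Jfun Jfun_submod.

Definition Sfun : lmodType k := lquot Jfun.

Definition Sclass (t : Lfun) : Sfun := lpi Jfun t.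

End Functors.

Definition fund_functor (k : comPzRingType) (E : finType) (R : corr E E)
    (X : finType) : lmodType k :=
  Sfun (fund_action R) X.

Section Lattice.
Context {d : Order.disp_t}.
Variable T : finTBLatticeType d.
Implicit Types a b e t : T.

Definition irreducible e : bool :=
  [forall A : {set T}, (e == \join_(a in A) a)%O ==> (e \in A)].

Definition Irr : finType := {e : T | irreducible e}.

Definition Irr_le : corr Irr Irr := [set p | (val p.1 <= val p.2)%O].

Definition rmap t : T := (\join_(s : T | (s < t)%O) s)%O.
Definition smap t : T := (\meet_(e : T | irreducible e && (t < e)%O) e)%O.

(* The iterates of rmap and smap are monotone sequences in T, hence stable
   after #|T| steps: see rinfP and sinfP. *)
Definition rinf t : T := iter #|T| rmap t.
Definition sinf t : T := iter #|T| smap t.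

Definition Gset : {set T} :=
  [set e | irreducible e] :|: [set a | a == rinf (sinf a)].

Definition Gc : {set T} :=
  [set a | ~~ irreducible a && (a < rinf (sinf a))%O].

Lemma iter_stable (r : rel T) (f : T -> T) : reflexive r -> transitive r ->
  antisymmetric r -> (forall t, r t (f t)) ->
  forall n t, (#|T| <= n)%N -> iter n f t = iter #|T| f t.
Proof.
move=> rr rt ra rf.
have rD t i m : r (iter i f t) (iter (m + i) f t).
  by elim: m => // m IH; apply: rt IH _; rewrite addSn iterS.
move=> n t.
have : looping f t #|T|.
  rewrite -[looping _ _ _]negbK -looping_uniq; apply/negP => /card_uniqP cu.
  by have := max_card (mem (traject f t #|T|.+1)); rewrite cu size_traject ltnn.
case/trajectP => i ilt eqi.
have fi : f (iter i f t) = iter i f t.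
  apply: ra; rewrite rf andbT -iterS -[X in r _ X]eqi.
  by rewrite -(subnK ilt) rD.
have st m : iter (m + i) f t = iter i f t.
  by elim: m => // m IH; rewrite addSn iterS IH.
move=> le; rewrite -(subnK (leq_trans (ltnW ilt) le)) st.
by rewrite -[in RHS](subnK (ltnW ilt)) st.
Qed.

Lemma rmap_le t : (rmap t <= t)%O.
Proof. by apply/joinsP => s /ltW. Qed.

Lemma rmap_ge s t : (s < t)%O -> (s <= rmap t)%O.
Proof. by move=> st; apply: (@Order.BJoinTheory.joins_sup _ _ _ s _ id). Qed.

Lemma rmap_mono : {homo rmap : s t / (s <= t)%O}.
Proof.
move=> s t st; apply/joinsP => x xs; apply: rmap_ge.
exact: lt_le_trans st.
Qed.

Lemma smap_ge t : (t <= smap t)%O.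
Proof. by apply/meetsP => e /andP [_ /ltW]. Qed.

Lemma rinfP n t : (#|T| <= n)%N -> iter n rmap t = rinf t.
Proof.
apply: (@iter_stable >=%O) => [x|y x z|x y|x] /=; rewrite ?rmap_le //.
- by move=> yx zy; apply: le_trans yx.
- by rewrite andbC; apply: le_anti.
Qed.

Lemma sinfP n t : (#|T| <= n)%N -> iter n smap t = sinf t.
Proof.
apply: (@iter_stable <=%O) => [x|y x z|x y|x] /=; rewrite ?smap_ge //.
- exact: le_trans.
- exact: le_anti.
Qed.

Lemma irreducibleE e : irreducible e = (rmap e < e)%O.
Proof.
rewrite lt_neqAle rmap_le andbT; apply/forallP/idP => [irr|ne A].
- apply/eqP => re; have := irr [set s | (s < e)%O].
  under eq_bigl do rewrite inE.
  by rewrite -/(rmap e) re eqxx inE ltxx.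
- apply/implyP => /eqP eA; apply: contraR ne => eNA; rewrite eq_le rmap_le.
  rewrite {1}eA; apply/joinsP => a aA; apply: rmap_ge.
  rewrite lt_neqAle {2}eA Order.BJoinTheory.joins_sup // andbT.
  by apply: contraNneq eNA => <-.
Qed.

Lemma rmap_fix t : ~~ irreducible t -> rmap t = t.
Proof. by rewrite irreducibleE lt_neqAle rmap_le andbT negbK => /eqP. Qed.

Lemma iter_rmap_mono n : {homo iter n rmap : s t / (s <= t)%O}.
Proof. by move=> s t st; elim: n => //= n; apply: rmap_mono. Qed.

Lemma iter_smap_ge n t : (t <= iter n smap t)%O.
Proof. by elim: n => //= n IH; apply: le_trans IH (smap_ge _). Qed.

Lemma rinf_fix t : ~~ irreducible t -> rinf t = t.
Proof. by move=> /rmap_fix rt; rewrite /rinf; elim: #|T| => //= n ->. Qed.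

Lemma GcE : Gc = ~: Gset.
Proof.
apply/setP => a; rewrite !inE negb_or; case: (boolP (irreducible a)) => //= Na.
rewrite lt_neqAle -[X in (X <= _)%O](rinf_fix Na).
by rewrite iter_rmap_mono ?iter_smap_ge // andbT.
Qed.

(* The map [c_0, ..., c_n]: the index of t is size c if t is not in c, so that
   both this t and c_n get the default value t. *)
Definition shift_map (c : seq T) : {ffun T -> T} :=
  [ffun t => nth t c (index t c).+1].

Definition chain_cond a (r : nat) : bool :=
  let b := rinf (sinf a) in
  sorted <%O (rcons (traject smap a r.+1) b) && (b <= iter r.+1 smap a)%O.

(* The bound on r is harmless, as the chain has r.+2 elements of T: see
   chain_lengthP. *)
Definition chain_length a : nat :=
  if [pick r : 'I_#|T| | chain_cond a r] is Some r then val r else 0%N.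

Lemma chain_condE a r :
  chain_cond a r =
  [&& [forall j : 'I_r, (iter j smap a < iter j.+1 smap a)%O],
      (iter r smap a < rinf (sinf a))%O &
      (rinf (sinf a) <= iter r.+1 smap a)%O].
Proof.
rewrite /chain_cond /= rcons_path last_traject -andbA; congr andb.
have nthE j : (j < r)%N ->
    nth a (a :: traject smap (smap a) r) j = iter j smap a /\
    nth a (traject smap (smap a) r) j = iter j.+1 smap a.
  move=> jr; rewrite -trajectS nth_traject ?ltnS ?(ltnW jr) //.
  by rewrite (set_nth_default (smap a)) ?size_traject // nth_traject // -iterSr.
apply/(pathP a)/forallP => [lt_p j|lt_j j]; rewrite ?size_traject.
  have [e1 e2] := nthE j (ltn_ord j).
  by have := lt_p j; rewrite size_traject e1 e2; apply.
by move=> jr; have [-> ->] := nthE j jr; apply: (lt_j (Ordinal jr)).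
Qed.

Lemma iter_smap_mono a i j : (i <= j)%N -> (iter i smap a <= iter j smap a)%O.
Proof. by move=> /subnK <-; rewrite iterD iter_smap_ge. Qed.

Lemma iter_smap_le a i : (iter i smap a <= sinf a)%O.
Proof.
rewrite -(sinfP a (leq_maxl #|T| i)).
exact: iter_smap_mono (leq_maxr _ _).
Qed.

Lemma rinf_comparable t x :
  (x <= t)%O -> (x <= rinf t)%O || (rinf t <= x)%O.
Proof.
move=> xt; rewrite /rinf; elim: #|T| => [|n] /=; first by rewrite xt.
case/orP => [|yx]; last by rewrite (le_trans (rmap_le _) yx) orbT.
rewrite le_eqVlt => /orP [/eqP -> |/rmap_ge -> //].
by rewrite rmap_le orbT.
Qed.

Lemma chain_lengthP a : a \in Gc ->
  chain_cond a (chain_length a) /\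
  forall r, chain_cond a r -> r = chain_length a.
Proof.
rewrite inE => /andP [_ ab].
set b := rinf (sinf a) in ab.
have uniq_r r q : chain_cond a r -> chain_cond a q -> r = q.
  wlog rq : r q / (r <= q)%N.
    by case: (leqP r q) => [/[swap]|/ltnW /[swap]] h /h {}h *; [|apply/esym];
       apply: h.
  rewrite !chain_condE => /and3P [_ _ br] /and3P [_ qb _].
  apply/eqP; rewrite eqn_leq rq leqNgt; apply/negP => {}rq.
  have := le_lt_trans (le_trans br (iter_smap_mono a rq)) qb.
  by rewrite ltxx.
suff [r rT cr] : exists2 r, (r < #|T|)%N & chain_cond a r.
  have cl : chain_cond a (chain_length a).
    rewrite /chain_length; case: pickP => [q //|/(_ (Ordinal rT))].
    by rewrite /= cr.
  by split=> // q cq; apply: uniq_r.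
have T0 : (0 < #|T|)%N by apply/card_gt0P; exists a.
have exr : exists r, (b <= iter r.+1 smap a)%O.
  exists #|T|.-1; rewrite prednK // -/(sinf a).
  by rewrite /b /rinf; elim: #|T| => //= n; apply: le_trans (rmap_le _).
have [r br minr] := ex_minnP exr.
have ltb j : (j <= r)%N -> (iter j smap a < b)%O.
  case: j => // j jr.
  have nb : ~~ (b <= iter j.+1 smap a)%O.
    by apply/negP => /minr; rewrite leqNgt jr.
  have := rinf_comparable (iter_smap_le a j.+1); rewrite -/b (negPf nb) orbF.
  by rewrite lt_neqAle => -> ; rewrite andbT; apply: contraNneq nb => ->.
exists r.
  rewrite -(prednK T0) ltnS; apply: minr; rewrite prednK // -/(sinf a).
  by rewrite /b /rinf; elim: #|T| => //= n; apply: le_trans (rmap_le _).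
rewrite chain_condE -/b br (ltb r) // !andbT.
apply/forallP => j; rewrite lt_neqAle smap_ge andbT; apply/eqP => eqj.
have st m : iter (m + j) smap a = iter j smap a.
  by elim: m => // m IH; rewrite addSn iterS IH.
have := ltb j (ltnW (ltn_ord j)); rewrite -(st (r.+1 - j)%N).
rewrite (subnK (leqW (ltnW (ltn_ord j)))) => /(le_lt_trans br).
by rewrite ltxx.
Qed.

Definition uchain a : seq T :=
  rcons (traject smap a (chain_length a).+1) (rinf (sinf a)).

Variable k : comPzRingType.

Definition u_elt a : kfree k {ffun T -> T} :=
  \sum_(i < (chain_length a).+1)
     (-1) ^+ i *: kbasis k (shift_map (take i.+2 (uchain a))).

Definition u_comp (s : seq T) : kfree k {ffun T -> T} :=
  foldr (fun a v => kmap_comp (u_elt a) v) (kbasis k [ffun t => t]) s.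

Variable X : finType.

Definition Gamma (phi : {ffun X -> T}) : corr X Irr :=
  [set p | (val p.2 <= phi p.1)%O].

Definition SIrr : lmodType k := fund_functor k (op_corr Irr_le) X.

Definition Theta_basis (phi : {ffun X -> T}) : SIrr :=
  Sclass (Ltens (fund_action (op_corr Irr_le))
            (kbasis k (Gamma phi)) (kbasis k 1%g)).

Definition Theta (v : kfree k {ffun X -> T}) : SIrr :=
  \sum_(phi : {ffun X -> T}) v phi *: Theta_basis phi.

Definition BX : {set {ffun X -> T}} :=
  [set phi : {ffun X -> T} |
     ([set e | irreducible e] \subset [set phi x | x : X]) &&
     ([set phi x | x : X] \subset Gset)].

End Lattice.

(* Main.v *)
(* A class of S(X) vanishes iff it is killed by every rho, and evaluating on rho
   and a permutation turns Gamma_phi into the 0/1 test "separates D phi", where D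
   attaches a subset of X to each irreducible e: phi takes the value e somewhere
   on D e and is bounded by e on D e.  Hence Theta(phi) = 0 unless E is contained
   in phi(X).  For a in G^c, let c_0 = a < c_1 < ... < c_(r+1) = b be the chain
   defining u_a: c_1, ..., c_r are irreducible, the ends are not, and b is in G.
   So the maps occurring in u_a only produce values in G or leave unchanged values
   other than a, which gives (a).  On the other hand the test for [c_0, ..., c_n]
   applied to phi is the sum of the tests of two consecutive "stages", so the
   alternating sum u_a telescopes and Theta(u_a phi) = Theta(phi), which gives (b). *)
From HB Require Import structures.
From mathcomp Require Import all_boot all_order all_algebra all_fingroup.
From mathcomp Require Import finmap boolp.
From mathcomp Require Import monalg.
Require Import Defs.

Set Implicit Arguments.
Unset Strict Implicit.
Unset Printing Implicit Defensive.

Import Order.TTheory GRing.Theory.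
Local Open Scope ring_scope.

(** * Spans and images of linear combinations *)

Section Span.
Variables (k : pzRingType) (V : lmodType k).

Lemma mem_lspan (P : V -> Prop) v : P v -> v \in lspan P.
Proof.
move=> Pv; apply/asboolP; exists [:: (1, v)]; rewrite big_seq1 scale1r.
by split=> // p; rewrite inE => /eqP ->.
Qed.

Lemma lspan_sub (P : V -> Prop) (S : submodClosed V) v :
  (forall w, P w -> w \in S) -> v \in lspan P -> v \in S.
Proof.
move=> PS /asboolP [l [Pl ->]]; rewrite big_seq; apply: rpred_sum => p pl.
exact/rpredZ/PS/Pl.
Qed.

End Span.

(** Linearity is a hypothesis on a bare function, so that partial applications such as
    [bilin_ext op u] qualify. *)
Lemma linear_sumZ (k : pzRingType) (V W : lmodType k) (f : V -> W) (I : Type)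
    (l : seq I) (P : pred I) (c : I -> k) (F : I -> V) : linear f ->
  f (\sum_(i <- l | P i) c i *: F i) = \sum_(i <- l | P i) c i *: f (F i).
Proof.
move=> lf; pose g : {linear V -> W} :=
  HB.pack f (GRing.isLinear.Build k V W *:%R f lf).
rewrite -[f]/(g : V -> W) linear_sum.
by apply: eq_bigr => i _; rewrite linearZ.
Qed.

(** * Linear and bilinear extension from the bases of free modules *)

Section LinearExtension.
Variables (k : comPzRingType) (Y : finType).

Section Def.
Variable (V : lmodType k).
Implicit Types (F : Y -> V) (v : kfree k Y).

Definition linext F v : V := \sum_(y : Y) v y *: F y.

Lemma linext_linear F : linear (linext F).
Proof.
move=> c u v; rewrite /linext scaler_sumr -big_split /=.
by apply: eq_bigr => y _; rewrite !ffunE scalerDl scalerA.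
Qed.

Lemma linext_basis F y : linext F (kbasis k y) = F y.
Proof.
rewrite /linext (bigD1 y) //= ffunE eqxx scale1r big1 ?addr0 // => z /negPf zy.
by rewrite ffunE zy scale0r.
Qed.

Lemma linextDr F G v : linext (fun y => F y + G y) v = linext F v + linext G v.
Proof. by rewrite -big_split; apply: eq_bigr => y _; rewrite scalerDr. Qed.

Lemma linextZr c F v : linext (fun y => c *: F y) v = c *: linext F v.
Proof.
by rewrite scaler_sumr; apply: eq_bigr => y _; rewrite !scalerA mulrC.
Qed.

Lemma eq_linext F G v : F =1 G -> linext F v = linext G v.
Proof. by move=> FG; apply: eq_bigr => y _; rewrite FG. Qed.

End Def.

HB.instance Definition _ (V : lmodType k) (F : Y -> V) :=
  GRing.isLinear.Build k (kfree k Y) V *:%R (linext F) (linext_linear F).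

Lemma linext_id (v : kfree k Y) : linext (kbasis k (Y := Y)) v = v.
Proof.
apply/ffunP => z; rewrite sum_ffunE (bigD1 z) //= big1 => [|y /negPf yz].
  by rewrite !ffunE eqxx addr0 [_ *: _]mulr1.
by rewrite !ffunE eq_sym yz scaler0.
Qed.

Lemma linear_linext (V W : lmodType k) (f : V -> W) (F : Y -> V) v :
  linear f -> f (linext F v) = linext (f \o F) v.
Proof. exact: linear_sumZ. Qed.

Lemma linear_basis (W : lmodType k) (f : kfree k Y -> W) v :
  linear f -> f v = linext (fun y => f (kbasis k y)) v.
Proof. by move=> lf; rewrite -{1}[v]linext_id (linear_linext _ _ lf). Qed.

Lemma mem_linext (V : lmodType k) (S : submodClosed V) (F : Y -> V) v :
  (forall y, F y \in S) -> linext F v \in S.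
Proof. by move=> FS; apply: rpred_sum => y _; apply: rpredZ. Qed.

End LinearExtension.

Section Bilinear.
Variables (k : comPzRingType) (Y1 Y2 : finType) (V : lmodType k).
Variable op : Y1 -> Y2 -> V.

Lemma bilin_extE u v :
  bilin_ext op u v = linext (fun y => linext (op y) v) u.
Proof.
apply: eq_bigr => y1 _; rewrite /linext scaler_sumr; apply: eq_bigr => y2 _.
by rewrite scalerA.
Qed.

Lemma bilin_ext_linearl v : linear (fun u => bilin_ext op u v).
Proof. by move=> c u w; rewrite !bilin_extE linearP. Qed.

Lemma bilin_ext_linearr u : linear (bilin_ext op u).
Proof.
move=> c v w; rewrite !bilin_extE -linextZr -linextDr.
by apply: eq_linext => y; rewrite linearP.
Qed.

Lemma bilin_ext_basis y1 y2 :
  bilin_ext op (kbasis k y1) (kbasis k y2) = op y1 y2.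
Proof. by rewrite bilin_extE !linext_basis. Qed.

End Bilinear.

Section Composition.
Variables (k : comPzRingType) (A B C D : finType).

Lemma kmap_compA (u : kfree k {ffun C -> D}) (v : kfree k {ffun B -> C})
    (w : kfree k {ffun A -> B}) :
  kmap_comp (kmap_comp u v) w = kmap_comp u (kmap_comp v w).
Proof.
rewrite {2 3}/kmap_comp !bilin_extE.
rewrite /kmap_comp (linear_linext _ _ (bilin_ext_linearl _ w)).
apply: eq_linext => h /=.
rewrite (linear_linext _ _ (bilin_ext_linearl _ w)).
rewrite [in RHS]bilin_extE (linear_linext _ _ (linext_linear _)).
apply: eq_linext => g /=.
rewrite bilin_extE linext_basis (linear_linext _ _ (linext_linear _)).
apply: eq_linext => f /=; rewrite linext_basis; congr (kbasis k _).
by apply/ffunP => x; rewrite !ffunE.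
Qed.

End Composition.

Lemma kmap_comp1l (k : comPzRingType) (X Y : finType)
    (v : kfree k {ffun X -> Y}) : kmap_comp (kbasis k [ffun y => y]) v = v.
Proof.
rewrite /kmap_comp bilin_extE linext_basis -[RHS]linext_id.
apply: eq_linext => f; congr (kbasis k _).
by apply/ffunP => x; rewrite !ffunE.
Qed.

(** * Calculus of pure tensors *)

Section TensorLinear.
Variables (k : pzRingType) (M N : lmodType k) (A : Type).
Variables (ract : M -> A -> M) (lact : A -> N -> N).

Lemma lspan_lpi_eq (V : lmodType k) (P : V -> Prop) u v :
  P (u - v) -> lpi (lspan P) u = lpi (lspan P) v.
Proof. by move=> Puv; apply/eqP; rewrite lpi_eq mem_lspan. Qed.

Lemma tens_linearl n : linear (fun m => tens ract lact m n).
Proof.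
move=> c m1 m2; rewrite /tens.
rewrite (lspan_lpi_eq (TensorDl ract lact (c *: m1) m2 n)) linearD /=.
congr (_ + _); rewrite -linearZ /=; exact: lspan_lpi_eq (TensorZl _ _ _ _ _).
Qed.

Lemma tens_linearr m : linear (tens ract lact m).
Proof.
move=> c n1 n2; rewrite /tens.
rewrite (lspan_lpi_eq (TensorDr ract lact m (c *: n1) n2)) linearD /=.
congr (_ + _); rewrite -linearZ /=; exact: lspan_lpi_eq (TensorZr _ _ _ _ _).
Qed.

Lemma tens_assoc m a n : tens ract lact (ract m a) n = tens ract lact m (lact a n).
Proof. exact: lspan_lpi_eq (TensorA ract lact m a n). Qed.

Lemma free_modE (K : choiceType) (g : free_mod k K) :
  g = \sum_(y <- msupp g) g@_y *: fm_gen k y.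
Proof.
rewrite [LHS]monalgE; apply: eq_bigr => y _; apply/malgP => z.
by rewrite fm_scaleE !mcoeffU mulrnAr mulr1.
Qed.

(** A representative is a combination of pairs [(m, n)], and each pair projects to a pure tensor. *)
Lemma tensor_lspan (t : tensor ract lact) :
  t \in lspan (fun t => exists m n, t = tens ract lact m n).
Proof.
rewrite -(lpi_repr t) [generic_quotient.repr _]free_modE linear_sum.
apply: rpred_sum => -[m n] _; rewrite linearZ rpredZ // mem_lspan //.
by exists m, n.
Qed.

End TensorLinear.

Lemma op_corrE (E : finType) (R : corr E E) e f :
  ((e, f) \in op_corr R) = ((f, e) \in R).
Proof.
apply/imsetP/idP => [[[f' e'] R' [-> ->]] //|Rfe].
by exists (f, e).
Qed.

(** * Vanishing and generators in the fundamental functor *)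

Section FundamentalFunctor.
Variables (k : comPzRingType) (E : finType) (R : corr E E).
Hypothesis Ranti : forall e f, (e, f) \in R -> (f, e) \in R -> e = f.

(** By antisymmetry of [R], the permutation found by [pick] is the only candidate. *)
Lemma fund_act_basis1E (Q : corr E E) (beta : {perm E}) :
  fund_act_basis k R Q 1 beta = (fund_perm R Q 1 beta)%:R.
Proof.
rewrite /fund_act_basis; case: pickP => [gamma Qg | Q0].
  rewrite mul1g ffunE; congr (nat_of_bool _)%:R.
  by apply/eqP/idP => [->|Qb] //; apply: fund_perm_uniq Qb Qg.
by rewrite ffunE Q0.
Qed.

(** If the correspondence of [alpha] followed by the inverse of [beta] contains the diagonal, then
    [beta = alpha]. So the basis element at [1] generates [fund_mod]. *)
Lemma fund_act_perm (alpha : {perm E}) :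
  (forall e, (e, e) \in R) ->
  fund_act R (kbasis k (perm_corr alpha)) (kbasis k 1%g) = kbasis k alpha.
Proof.
move=> Rrefl; rewrite /fund_act bilin_ext_basis; apply/ffunP => beta.
rewrite fund_act_basis1E ffunE; congr (nat_of_bool _)%:R.
apply/idP/eqP => [/andP [/subsetP db _]|->].
  apply/permP => e; have /db : (e, e) \in diag E by apply/imsetP; exists e.
  by rewrite mem_perm_corrV => /imsetP [x _ [-> ->]].
apply/andP; split; apply/subsetP => -[e f].
  by case/imsetP => x _ [-> ->]; rewrite mem_perm_corrV; apply/imsetP; exists x.
rewrite mem_perm_corrV => /imsetP [x _ [/perm_inj -> ->]].
by apply/imsetP; exists (x, x); rewrite //= !perm1.
Qed.

Variable X : finType.
Local Notation act := (fund_action (k := k) R).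
Local Notation cls u w := (Sclass (Ltens act (X := X) u w)).

Lemma Sclass_linearl w : linear (fun u => cls u w).
Proof. by move=> c u v; rewrite /Sclass /Ltens tens_linearl linearP. Qed.

Lemma Sclass_linearr u : linear (fun w => cls u w).
Proof. by move=> c w v; rewrite /Sclass /Ltens tens_linearr linearP. Qed.

(** The one-term sum [u] tensor [f_R] itself witnesses membership in [Jfun]. By linearity it is
    enough to test single correspondences [rho], one coefficient [beta] at a time. *)
Lemma Sclass_eq0 (u : kfree k (corr X E)) :
  (forall rho beta,
    linext (V := k^o)
      (fun S => (fund_perm R (corr_comp rho S) 1 beta)%:R) u = 0) ->
  cls u (kbasis k 1%g) = 0.
Proof.
move=> u0; apply/eqP.
rewrite -(linear0 (lpi (Jfun (act := act) (X := X)))) lpi_eq subr0.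
apply/asboolP; exists [:: (u, kbasis k 1%g)].
split=> [|rho]; rewrite big_seq1 //=.
rewrite /kcorr_comp bilin_extE /fund_act (linear_linext _ _ (bilin_ext_linearl _ _)).
apply: big1 => r _ /=; rewrite (linear_linext _ _ (bilin_ext_linearl _ _)).
rewrite [X in _ *: X](_ : _ = 0) ?scaler0 //; apply/ffunP => beta.
rewrite ffunE -[RHS](u0 r beta) sum_ffunE; apply: eq_bigr => S _ /=.
by rewrite bilin_ext_basis ffunE fund_act_basis1E.
Qed.

Lemma fund_functor_lspan (v : fund_functor k R X) :
  (forall e, (e, e) \in R) ->
  v \in lspan (fun t => exists S, t = cls (kbasis k S) (kbasis k 1%g)).
Proof.
move=> Rrefl; have [t ->] : exists t, v = Sclass t.
  by exists (generic_quotient.repr v); rewrite /Sclass lpi_repr.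
have /asboolP [l [Pl ->]] := tensor_lspan t.
rewrite /Sclass linear_sum big_seq; apply: rpred_sum => -[c _] /Pl [u [w ->]] /=.
rewrite linearZ rpredZ //= -/(Ltens act u w) -/(Sclass _).
rewrite (linear_basis _ (Sclass_linearl w)); apply: mem_linext => S.
rewrite (linear_basis _ (Sclass_linearr _)); apply: mem_linext => alpha.
(* The basis element at [alpha] is [perm_corr alpha] acting on the one at [1]; moving that action
   across the tensor sign composes it with [S]. *)
apply: mem_lspan; exists (corr_comp S (perm_corr alpha)); congr Sclass.
rewrite -(fund_act_perm alpha Rrefl) -[RHS]/(tens _ _ _ _) -(bilin_ext_basis
  (fun S Q => kbasis k (corr_comp S Q)) S (perm_corr alpha)).
by rewrite [RHS]tens_assoc.
Qed.

End FundamentalFunctor.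

(** * Irreducible elements, the maps [rmap] and [smap], and the chains *)

Section Lattice.
Context {d : Order.disp_t}.
Variable T : finTBLatticeType d.
Implicit Types a b e s t : T.
Local Open Scope order_scope.

(** Induction on the number of elements strictly below [s]: a reducible [s] is the join [rmap s] of
    these elements. *)
Lemma le_irreducible s t :
  (forall e, irreducible e -> e <= s -> e <= t) -> s <= t.
Proof.
have [n] := ubnP #|[set x | x < s]|.
elim: n s => // n IH s; rewrite ltnS => sn irr_le.
have [s_irr|/rmap_fix sE] := boolP (irreducible s); first exact: irr_le.
rewrite -sE; apply/joinsP => x xs; apply: IH => [|e e_irr ex]; last first.
  by apply: irr_le (le_trans ex (ltW xs)).
apply: leq_trans sn; apply: proper_card; apply/properP; split.
  by apply/subsetP => y; rewrite !inE => /lt_trans; apply.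
by exists x; rewrite inE ?ltxx.
Qed.

(** Otherwise every [F i] is strictly below [e], hence below [rmap e], and so would be their join
    [e]. *)
Lemma irreducible_join_mem (I : finType) (P : pred I) (F : I -> T) e :
  irreducible e -> e = \join_(i | P i) F i -> exists2 i, P i & F i = e.
Proof.
rewrite irreducibleE => re eE.
have [/exists_inP [i Pi /eqP Fi]|] := boolP [exists (i | P i), F i == e].
  by exists i.
rewrite negb_exists_in => /forall_inP none; case/negP: (negbT (lt_geF re)).
rewrite {1}eE; apply/joinsP => i Pi; apply: rmap_ge.
by rewrite lt_neqAle none //= eE (Order.BJoinTheory.joins_sup (j := i)).
Qed.

Lemma smap_mono : {homo (@smap _ T) : s t / s <= t}.
Proof.
move=> s t st; apply/meetsP => e /andP [e_irr te].
by apply: meets_inf; rewrite e_irr (le_lt_trans st).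
Qed.

Lemma smap_le e t : irreducible e -> t < e -> smap t <= e.
Proof. by move=> e_irr te; apply: meets_inf; rewrite e_irr. Qed.

(** If [smap t] is reducible, every irreducible above [t] lies strictly above [smap t], so applying
    [smap] again gives nothing larger. *)
Lemma smap_irreducible t : smap t < smap (smap t) -> irreducible (smap t).
Proof.
apply: contraTT => Nirr; apply/negP => /lt_geF/negP [].
apply/meetsP => e /andP [e_irr te].
apply: smap_le => //; rewrite lt_neqAle smap_le // andbT.
by apply: contraNneq Nirr => ->.
Qed.

Lemma smap_sinf t : smap (sinf t) = sinf t.
Proof. exact: sinfP (leqnSn _). Qed.

Lemma sinf_mono : {homo (@sinf _ T) : s t / s <= t}.
Proof. by move=> s t st; rewrite /sinf; elim: #|T| => //= n; apply: smap_mono. Qed.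

Lemma sinf_id t : sinf (sinf t) = sinf t.
Proof. by rewrite {1}/sinf; elim: #|T| => //= n ->; rewrite smap_sinf. Qed.

Lemma rmap_rinf t : rmap (rinf t) = rinf t.
Proof. exact: rinfP (leqnSn _). Qed.

Lemma rinf_reducible t : ~~ irreducible (rinf t).
Proof. by rewrite irreducibleE rmap_rinf ltxx. Qed.

Lemma rinf_le t : rinf t <= t.
Proof. by rewrite /rinf; elim: #|T| => //= n; apply: le_trans (rmap_le _). Qed.

(** With [b = rinf (sinf a)], the bounds [a <= b <= sinf a] give [sinf b = sinf a]. *)
Lemma rinf_sinf_Gset a : a \in Gc T -> rinf (sinf a) \in Gset T.
Proof.
rewrite !inE => /andP [_ /ltW ab]; apply/orP; right; apply/eqP; congr rinf.
apply: le_anti; rewrite sinf_mono //=.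
by rewrite -{2}(sinf_id a) sinf_mono // rinf_le.
Qed.

Section Chain.
Variable a : T.
Hypothesis aGc : a \in Gc T.
Local Notation r := (chain_length a).
Local Notation c := (uchain a).

Lemma size_uchain : size c = r.+2.
Proof. by rewrite size_rcons size_traject. Qed.

Lemma nth_uchain x0 j : (j <= r)%N -> nth x0 c j = iter j (@smap _ T) a.
Proof.
move=> jr; rewrite nth_rcons size_traject ltnS jr.
by rewrite (set_nth_default a) ?size_traject // nth_traject.
Qed.

Lemma nth_uchain_last x0 : nth x0 c r.+1 = rinf (sinf a).
Proof. by rewrite nth_rcons size_traject ltnn eqxx. Qed.

Lemma uchain_sorted : sorted <%O c.
Proof. by have [/andP []] := chain_lengthP aGc. Qed.

(** These entries are values of [smap] that [smap] strictly increases; for [j = r] this follows from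
    [b] lying strictly above the entry and below its image. *)
Lemma uchain_irreducible x0 j :
  (0 < j <= r)%N -> irreducible (nth x0 c j).
Proof.
case: j => // j jr; rewrite nth_uchain // iterS; apply: smap_irreducible.
rewrite -!iterS; have [+ _] := chain_lengthP aGc.
rewrite chain_condE => /and3P [/forallP lt_r rb br].
case/andP: jr => _; rewrite leq_eqVlt => /orP [/eqP ->|jr]; first exact: lt_le_trans br.
exact: lt_r (Ordinal jr).
Qed.

Lemma uchain_next x0 j e : (j <= r)%N -> irreducible e ->
  nth x0 c j < e -> nth x0 c j.+1 <= e.
Proof.
move=> jr e_irr; rewrite nth_uchain // => /(smap_le e_irr); rewrite -iterS.
move: jr; rewrite leq_eqVlt => /orP [/eqP ->|jr]; last by rewrite nth_uchain.
(* The last entry [b] is not an iterate of [smap], but it is bounded by the next iterate. *)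
rewrite nth_uchain_last; apply: le_trans.
by have [+ _] := chain_lengthP aGc; rewrite chain_condE => /and3P [].
Qed.

Lemma uchain_Gset x0 j : (0 < j <= r.+1)%N -> nth x0 c j \in Gset T.
Proof.
move=> /andP [j0]; rewrite leq_eqVlt => /orP [/eqP ->|jr].
  by rewrite nth_uchain_last rinf_sinf_Gset.
by rewrite !inE uchain_irreducible ?j0.
Qed.

End Chain.

Lemma shift_map_take (c : seq T) n t : (n < size c)%N ->
  shift_map (take n.+1 c) t =
    if (index t c < n)%N then nth t c (index t c).+1 else t.
Proof.
move=> nc; rewrite ffunE.
have tE : index t (take n.+1 c) = minn n.+1 (index t c).
  rewrite -{2}(cat_take_drop n.+1 c) index_cat size_takel //.
  case: ifPn => [|/memNindex ->].
    by rewrite -index_mem size_takel // => /ltnW/minn_idPr.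
  by rewrite size_takel //; apply/esym/minn_idPl/leq_addr.
case: ifPn => [tn|]; last rewrite -leqNgt => nt.
  by rewrite tE (minn_idPr _) ?nth_take // leqW // ltnW.
by rewrite nth_default // size_takel // tE ltnS leq_min leqnSn.
Qed.
End Lattice.

(** * The combinatorial test replacing the action of correspondences *)

Section Separation.
Context {d : Order.disp_t}.
Variable T : finTBLatticeType d.
Variables (X : finType).
Implicit Types (D : T -> pred X) (phi : {ffun X -> T}).

(** [D] is indexed by [T] rather than [Irr T], so that chain elements can serve as indices without a
    proof of irreducibility. *)
Definition separates D phi : bool :=
  [forall e : T, irreducible e ==>
     [exists x, D e x && (phi x == e)] &&
     [forall x, D e x ==> (phi x <= e)%O]].

Lemma separatesP D phi :
  reflect (forall e, irreducible e ->
             (exists2 x, D e x & phi x = e) /\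
             (forall x, D e x -> (phi x <= e)%O))
          (separates D phi).
Proof.
apply: (iffP forallP) => sep e.
  move=> e_irr; have := sep e; rewrite e_irr /=.
  move=> /andP [/existsP [x /andP [Dx /eqP phix]] /forallP le_e].
  by split=> [|y Dy]; [exists x | have := le_e y; rewrite Dy].
apply/implyP => /sep [[x Dx phix] le_e]; apply/andP; split.
  by apply/existsP; exists x; rewrite Dx phix eqxx.
by apply/forallP => y; apply/implyP/le_e.
Qed.

(* The row of rho at beta e, extended by the empty row to reducible elements. *)
Definition pull_rel (rho : corr (Irr T) X) (beta : {perm Irr T}) : T -> pred X :=
  fun t x => if insub t is Some e then (beta e, x) \in rho else false.

(* Both conditions of fund_perm only depend on the joins of the rows of S,
   since an irreducible element that is a join of a row belongs to it. *)
Lemma fund_perm_join (S : corr X (Irr T)) phi rho beta :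
  (forall x, phi x = \join_(e | (x, e) \in S) val e)%O ->
  fund_perm (op_corr (Irr_le T)) (corr_comp rho S) 1 beta =
    separates (pull_rel rho beta) phi.
Proof.
move=> phiE; rewrite /fund_perm; apply/andP/separatesP.
  move=> [/subsetP dg /subsetP le_op] e e_irr.
  pose e' : Irr T := Sub e e_irr.
  have pE x : pull_rel rho beta e x = ((beta e', x) \in rho).
    by rewrite /pull_rel (insubT (fun e => irreducible e) e_irr).
  have le_e x : pull_rel rho beta e x -> (phi x <= e)%O.
    rewrite pE phiE => rx; apply/joinsP => f Sf.
    have /le_op/imsetP [[p q]] :
        (e', f) \in corr_comp (perm_corr beta^-1%g) (corr_comp rho S).
      by rewrite mem_perm_corrV inE; apply/existsP; exists x; rewrite rx.
    by rewrite op_corrE inE /= !perm1 -[e]/(val e') => le_pq [-> ->].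
  split=> //; have /dg : (e', e') \in diag (Irr T) by apply/imsetP; exists e'.
  rewrite mem_perm_corrV inE => /existsP [x /= /andP [rx Sx]].
  exists x; rewrite ?pE //; apply: le_anti; rewrite le_e ?pE // phiE.
  by rewrite (@Order.BJoinTheory.joins_sup _ _ _ (e') _ val).
move=> sep.
have pE (e : Irr T) x : pull_rel rho beta (val e) x = ((beta e, x) \in rho).
  by rewrite /pull_rel valK.
split; apply/subsetP => -[e f].
  case/imsetP => e0 _ [-> ->]; rewrite mem_perm_corrV inE.
  have [[x]] := sep _ (valP e0).
  rewrite pE phiE => rx /esym/(irreducible_join_mem (valP e0)) [g Sg /val_inj ge] _.
  by apply/existsP; exists x; rewrite rx -ge.
rewrite mem_perm_corrV inE => /existsP [x /= /andP [rx Sx]].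
apply/imsetP; exists (e, f); rewrite /= ?perm1 //.
rewrite op_corrE inE /=.
apply: (@le_trans _ _ (phi x)).
  by rewrite phiE (@Order.BJoinTheory.joins_sup _ _ _ (f) _ val).
by have [_] := sep _ (valP e); apply; rewrite pE.
Qed.

(** Every element is the join of the irreducibles below it; this puts [Gamma phi] within the scope
    of [fund_perm_join]. *)
Lemma Gamma_join phi x : (phi x = \join_(e | (x, e) \in Gamma phi) val e)%O.
Proof.
apply: le_anti; apply/andP; split; last first.
  by apply/joinsP => e; rewrite inE.
apply: le_irreducible => e e_irr ex.
rewrite -[e]/(val (Sub e e_irr : Irr T)).
by rewrite (@Order.BJoinTheory.joins_sup _ _ _ (Sub e e_irr) _ val) // inE.
Qed.

End Separation.

Lemma alternating_telescope (k : pzRingType) (A : nat -> k) n :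
  \sum_(i < n) (-1) ^+ i * (A i + A i.+1) = A 0%N - (-1) ^+ n * A n.
Proof.
elim: n => [|n IH]; first by rewrite big_ord0 expr0 mul1r subrr.
by rewrite big_ord_recr IH /= mulrDr exprS !mulN1r mulNr opprK addrA subrK.
Qed.

(** * The test along a chain, and its alternating sum *)

Section ShiftedChain.
Context {d : Order.disp_t}.
Variables (T : finTBLatticeType d) (X : finType).
Variables (D : T -> pred X) (phi : {ffun X -> T}).
Variables (x0 : T) (c : seq T) (r : nat).
Local Open Scope order_scope.
Local Notation elt := (@nth T x0 c).
Hypothesis sz_c : size c = r.+2.
Hypothesis c_sorted : sorted <%O c.
Hypothesis c_first : ~~ irreducible (elt 0).
Hypothesis c_last : ~~ irreducible (elt r.+1).
Hypothesis c_irr : forall j, (0 < j <= r)%N -> irreducible (elt j).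
Hypothesis c_next : forall j e, (j <= r)%N -> irreducible e ->
  elt j < e -> elt j.+1 <= e.

(** This is [c_0, ..., c_n] composed with [phi]; for [n = 0] the list has one entry and the shift is
    the identity, so [m 0] is [phi]. *)
Let m n := map_comp (shift_map (take n.+1 c)) phi.

Let index_c j : (j <= r.+1)%N -> index (elt j) c = j.
Proof.
by move=> jr; rewrite index_uniq ?sz_c // (sorted_uniq lt_trans ltxx).
Qed.

Let lt_c i j : (i < j <= r.+1)%N -> elt i < elt j.
Proof.
move=> /andP [ij jr]; rewrite (sorted_ltn_nth lt_trans) ?inE ?sz_c //.
exact: leq_ltn_trans (ltnW ij) _.
Qed.

Let mE n x : (n <= r.+1)%N ->
  m n x = if (index (phi x) c < n)%N then elt (index (phi x) c).+1 else phi x.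
Proof.
move=> nr; rewrite /m ffunE shift_map_take ?sz_c //; case: ifP => // ltn.
by apply: set_nth_default; rewrite sz_c ltnS; apply: leq_trans ltn nr.
Qed.

Let m_moved n x j : (j < n <= r.+1)%N -> phi x = elt j -> m n x = elt j.+1.
Proof.
by move=> /andP [jn nr] phix; rewrite mE // phix index_c ?jn // ltnW ?(leq_trans jn).
Qed.

Let m_fixed n x j : (n <= j <= r.+1)%N -> phi x = elt j -> m n x = elt j.
Proof.
move=> /andP [nj jr] phix; rewrite mE ?(leq_trans nj) // phix index_c //.
by rewrite ltnNge nj.
Qed.

Let mP n x : (n <= r.+1)%N ->
  m n x = phi x \/ exists2 j, (j < n)%N & phi x = elt j /\ m n x = elt j.+1.
Proof.
move=> nr; rewrite mE //; case: ifPn => idx; last by left.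
right; exists (index (phi x) c) => //; rewrite nth_index //.
by rewrite -index_mem sz_c ltnS (leq_trans (ltnW idx)).
Qed.

Let m_ge n x : (n <= r.+1)%N -> phi x <= m n x.
Proof.
move=> nr; case: (mP x nr) => [->|[j jn [-> ->]]] //.
by apply/ltW/lt_c; rewrite ltnSn /= (leq_trans jn).
Qed.

Let hit j i := [exists x, D (elt j) x && (phi x == elt i)].

(** The part of the test common to all stages: the bounds are imposed on [phi] itself, and values
    must be attained only at irreducibles outside the chain. *)
Let off_chain :=
  [forall e : T, irreducible e ==>
     ((e \notin c) ==> [exists x, D e x && (phi x == e)]) &&
     [forall x, D e x ==> (phi x <= e)]].

(* On D c_(j+1), phi takes the value c_j but not c_(j+1) if j < q, and the value
   c_(j+1) if j >= q.  The test of [c_0, ..., c_n] o phi succeeds iff stage n.-1 or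
   stage n holds, and consecutive stages exclude each other. *)
Let stage q := [&& (q <= r)%N, off_chain &
  [forall j : 'I_r, if (j < q)%N then ~~ hit j.+1 j.+1 && hit j.+1 j
                    else hit j.+1 j.+1]].

Let stage_separates q n : (q <= n <= q.+1)%N -> (n <= r.+1)%N ->
  stage q -> separates D (m n).
Proof.
move=> /andP [qn nq] nr /and3P [qr /forallP off /forallP on].
apply/separatesP => e e_irr.
have := off e; rewrite e_irr => /andP [off_e /forallP le_e].
split; last first.
  move=> x Dx; have := le_e x; rewrite Dx /=.
  case: (mP x nr) => [-> //|[j jn [phix ->]]]; rewrite phix le_eqVlt.
  have jr : (j <= r)%N by rewrite -ltnS (leq_trans jn).
  case/orP => [/eqP ej|]; last exact: c_next.
  (* Here [x] lies in D c_j with [phi x] = c_j = [e]. Reducibility of c_0 excludes [j = 0], and the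
     stage forbids such an [x] for the other indices. *)
  case: j jn phix ej jr => [|j] jn phix ej jr.
    by move: c_first; rewrite ej e_irr.
  have jq : (j < q)%N by rewrite -ltnS (leq_trans jn).
  have := on (Ordinal jr); rewrite /= jq.
  case/andP => /existsP []; exists x.
  by rewrite ej Dx phix ej eqxx.
have [ec|ec] := boolP (e \in c); last first.
  have /existsP [x /andP [Dx /eqP phix]] := implyP off_e ec.
  exists x; rewrite // -phix; case: (mP x nr) => // -[j jn [phixj _]].
  case/negP: ec; rewrite -phix phixj mem_nth // sz_c ltnS.
  exact: leq_trans (ltnW jn) nr.
have [j jr ej] : exists2 j, (j <= r.+1)%N & e = elt j.
  by exists (index e c); rewrite ?nth_index // -ltnS -sz_c index_mem.
(* Both ends of the chain are reducible, so an irreducible chain element is c_(j+1) with [j < r]. *)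
case: j jr ej => [|j] jr ej; first by case/negP: c_first; rewrite -[elt 0]ej.
have {}jr : (j < r)%N.
  rewrite ltn_neqAle -ltnS jr andbT; apply: contraNneq c_last => <-.
  by move: e_irr; rewrite ej.
have := on (Ordinal jr); rewrite /hit /= -ej; case: ltnP => jq.
  case/andP => _ /existsP [x /andP [Dx /eqP phix]]; exists x; rewrite // ej.
  by apply: m_moved phix; rewrite nr (leq_trans jq).
case/existsP => x /andP [Dx /eqP phix]; exists x; rewrite // [RHS]ej.
by apply: m_fixed; rewrite ?(leq_trans nq) //= ?phix // ltnS ltnW.
Qed.

(** The test for [m n] leaves only [hit n n] undetermined, and this decides between the stages
    [n.-1] and [n]. For [n = 0] and [n = r.+1] there is nothing to decide. *)
Let separates_stage q n : (q <= n <= q.+1)%N -> (n <= r.+1)%N -> (q <= r)%N ->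
  ((0 < n <= r)%N -> hit n n = (q < n)%N) -> separates D (m n) -> stage q.
Proof.
move=> /andP [qn nq] nr qr hit_n /separatesP sep.
apply/and3P; split=> //.
  apply/forallP => e; apply/implyP => e_irr.
  have [[x Dx mx] le_e] := sep e e_irr.
  apply/andP; split; last first.
    apply/forallP => y; apply/implyP => Dy.
    exact: le_trans (m_ge y nr) (le_e y Dy).
  apply/implyP => ec; apply/existsP; exists x; rewrite Dx /=.
  case: (mP x nr) => [<-|[j jn [_ mj]]]; first by rewrite mx.
  by case/negP: ec; rewrite -mx mj mem_nth // sz_c ltnS (leq_trans jn).
apply/forallP => -[j jr] /=.
have [[x Dx mx] le_e] := sep _ (c_irr (j := j.+1) jr).
(* The value c_(j+1) of [m n] comes either from an unmoved c_(j+1) or from c_j shifted by one. *)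
have xP : phi x = elt j.+1 \/ (j < n)%N /\ phi x = elt j.
  case: (mP x nr) => [<-|[i i_n [phix mi]]]; first by left.
  right; suff <- : i = j by [].
  have /(congr1 (index^~ c)) : elt i.+1 = elt j.+1 by rewrite -mi.
  by rewrite !index_c ?(leq_trans i_n) //; [case | rewrite ltnW].
case: ltnP => jq; last first.
  apply/existsP; case: xP => [phix|[jn phix]].
    by exists x; rewrite Dx phix eqxx.
  have nj : n = j.+1.
    by apply/eqP; rewrite eqn_leq jn (leq_trans nq).
  apply/existsP; rewrite -/(hit j.+1 j.+1) -nj hit_n // nj //.
(* If [j.+1 < n], a hit would be moved to c_(j+2), violating the bound by c_(j+1). Otherwise
   [n = j.+1 = q], and [hit_n] applies. *)
have Nhit : ~~ hit j.+1 j.+1.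
  have [jn|nj] := ltnP j.+1 n.
    apply/existsP => -[y /andP [Dy /eqP phiy]].
    have := le_e y Dy; rewrite (m_moved _ phiy) ?jn //.
    by rewrite lt_geF // lt_c // ltnSn /= (leq_trans jn).
  have nj' : n = j.+1 by apply/eqP; rewrite eqn_leq nj (leq_trans jq).
  by rewrite -nj' hit_n ?nj' // ltnNge jq.
rewrite Nhit; apply/existsP; exists x; rewrite Dx.
case: xP => [phix|[_ phix]]; last by rewrite phix eqxx.
case/existsP: Nhit.
by exists x; rewrite Dx phix eqxx.
Qed.

Let stage_disjoint q : stage q -> stage q.+1 -> false.
Proof.
move=> /and3P [_ _ /forallP on] /and3P [qr _ /forallP on'].
have := on (Ordinal qr); rewrite /= ltnn => hq.
by have := on' (Ordinal qr); rewrite /= ltnSn hq.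
Qed.

Let separates0 : separates D (m 0) = stage 0.
Proof.
by apply/idP/idP; [apply: separates_stage | apply: stage_separates].
Qed.

Let separatesS n : (n <= r)%N ->
  separates D (m n.+1) = (stage n + stage n.+1)%N :> nat.
Proof.
move=> nr; have [sep|Nsep] := boolP (separates D (m n.+1)); last first.
  have [st|_] := boolP (stage n).
    by case/negP: Nsep; apply: stage_separates st; rewrite ?leqnSn ?leqnn.
  have [st|//] := boolP (stage n.+1).
  by case/negP: Nsep; apply: stage_separates st; rewrite ?leqnSn ?leqnn.
have [st|Nst] := boolP (stage n); have [st'|Nst'] := boolP (stage n.+1) => //.
  by have := stage_disjoint st st'.
(* A miss at c_(n+1) with [n < r] yields stage [n.+1]; a hit, or [n = r], yields stage [n]. *)
have [/andP [nr' Nhit]|] := boolP ((n < r)%N && ~~ hit n.+1 n.+1).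
  case/negP: Nst'; apply: separates_stage sep; rewrite ?leqnSn ?leqnn //= ?ltnn.
  by move=> _; apply: negbTE.
rewrite negb_and negbK -leqNgt => hitP.
case/negP: Nst; apply: separates_stage sep; rewrite ?leqnSn ?leqnn //= ?ltnSn.
by move=> nr'; case/orP: hitP => //; rewrite leqNgt nr'.
Qed.

(** The sum telescopes from stage 0, which is the test for [phi], to stage [r.+1], which is false by
    its bound on [q]. *)
Lemma separates_alternating (k : pzRingType) :
  \sum_(n < r.+1) (-1) ^+ n * (separates D (m n.+1))%:R =
  (separates D phi)%:R :> k.
Proof.
have phiE : phi = m 0 by apply/ffunP => x; rewrite mE.
rewrite phiE separates0.
transitivity (\sum_(n < r.+1) (-1) ^+ n * ((stage n)%:R + (stage n.+1)%:R) : k).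
  by apply: eq_bigr => n _; rewrite separatesS ?natrD // -ltnS.
rewrite (alternating_telescope (fun n => (stage n)%:R)).
by rewrite [stage r.+1]/stage ltnn /= mulr0 subr0.
Qed.

End ShiftedChain.

(** * Effect of the elements u_a on values and on [Theta] *)

Section Generation.
Context {d : Order.disp_t}.
Variables (T : finTBLatticeType d) (k : comPzRingType) (X : finType).
Implicit Types (phi f : {ffun X -> T}) (v w : kfree k {ffun X -> T}).

Lemma kmap_comp_u_elt a phi :
  kmap_comp (u_elt k a) (kbasis k phi) =
  \sum_(i < (chain_length a).+1)
     (-1) ^+ i *: kbasis k (map_comp (shift_map (take i.+2 (uchain a))) phi).
Proof.
rewrite /u_elt /kmap_comp.
rewrite (linear_sumZ _ _ _ _ (bilin_ext_linearl _ _)).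
by apply: eq_bigr => i _; rewrite bilin_ext_basis.
Qed.

(** The invariant for composing the u_a one by one: reducible values outside [Gset] may remain as
    long as they are not in the part [s] already treated. *)
Let values_in (s : seq T) v :=
  exists2 f : {ffun X -> T}, (forall x, (f x \in Gset T) || (f x \notin s))
    & v = kbasis k f.

Lemma u_elt_avoid a (s : seq T) v : a \in Gc T ->
  v \in lspan (values_in s) ->
  kmap_comp (u_elt k a) v \in lspan (values_in (a :: s)).
Proof.
move=> aGc /asboolP [l [Pl ->]].
rewrite /kmap_comp (linear_sumZ _ _ _ _ (bilin_ext_linearr _ _)) big_seq.
apply: rpred_sum => -[z w] /Pl [f fs /= ->]; rewrite rpredZ //.
rewrite -/(kmap_comp _ _) kmap_comp_u_elt.
apply: rpred_sum => i _; rewrite rpredZ // mem_lspan //.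
eexists; last reflexivity; move=> x; rewrite ffunE.
have ir : (i.+1 < size (uchain a))%N by rewrite size_uchain ltnS ltn_ord.
rewrite shift_map_take //; case: ifPn => [idx|].
  by rewrite uchain_Gset //= (leq_trans idx (ltn_ord i)).
case/orP: (fs x) => [->//|fxs idx]; rewrite inE negb_or fxs andbT orbC.
(* An unmoved value is not [a]: as the first entry of the chain, [a] has index 0 and is always
   moved. *)
apply/orP; left; apply/eqP => fxa; case/negP: idx.
by rewrite fxa /uchain /= eqxx.
Qed.

Lemma u_comp_avoid (s : seq T) phi : {subset s <= Gc T} ->
  kmap_comp (u_comp k s) (kbasis k phi) \in lspan (values_in s).
Proof.
elim: s => [|a s IH] sGc /=.
  by rewrite kmap_comp1l mem_lspan //; exists phi => // x; rewrite orbT.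
rewrite kmap_compA; apply: u_elt_avoid; first by rewrite sGc ?mem_head.
by apply: IH => b bs; apply: sGc; rewrite inE bs orbT.
Qed.

Lemma Theta_linear : linear (@Theta d T k X).
Proof. exact: linext_linear. Qed.

Lemma Theta_kbasis phi : Theta (kbasis k phi) = Theta_basis k phi.
Proof. exact: linext_basis. Qed.

Let op_anti (e f : Irr T) :
  (e, f) \in op_corr (Irr_le T) -> (f, e) \in op_corr (Irr_le T) -> e = f.
Proof.
by rewrite !op_corrE !inE /= => fe ef; apply/val_inj/le_anti; rewrite ef.
Qed.

(** Each pair [rho], [beta] gives the test with [D = pull_rel rho beta], so the functionals
    [separates D] detect zero. *)
Lemma Theta_eq0 v :
  (forall D, linext (V := k^o) (fun phi => (separates D phi)%:R) v = 0) ->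
  Theta v = 0.
Proof.
move=> v0.
have -> : Theta v = Sclass (Ltens (fund_action (op_corr (Irr_le T)))
    (linext (fun phi => kbasis k (Gamma phi)) v) (kbasis k 1%g)).
  by rewrite (linear_linext _ _ (Sclass_linearl _ _)).
apply: Sclass_eq0 => [|rho beta]; first exact: op_anti.
rewrite (linear_linext _ _ (linext_linear _)) -[RHS](v0 (pull_rel rho beta)).
apply: eq_linext => phi /=; rewrite linext_basis.
by rewrite (fund_perm_join _ _ (Gamma_join phi)).
Qed.

Lemma Theta_eq v w :
  (forall D, linext (V := k^o) (fun phi => (separates D phi)%:R) v =
             linext (V := k^o) (fun phi => (separates D phi)%:R) w) ->
  Theta v = Theta w.
Proof.
move=> vw; apply/eqP; rewrite -subr_eq0 addrC -scaleN1r -Theta_linear.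
by rewrite Theta_eq0 // => D; rewrite linearP /= -vw scaleN1r addNr.
Qed.

Lemma Theta_u_elt a v : a \in Gc T -> Theta (kmap_comp (u_elt k a) v) = Theta v.
Proof.
move=> aGc; apply: Theta_eq => D.
rewrite /kmap_comp (linear_basis _ (bilin_ext_linearr _ _)).
rewrite (linear_linext _ _ (linext_linear _)); apply: eq_linext => phi /=.
rewrite -[bilin_ext _ _ _]/(kmap_comp (u_elt k a) (kbasis k phi)).
rewrite kmap_comp_u_elt linear_sum /=.
have Gc_a : ~~ irreducible a by move: aGc; rewrite inE => /andP [].
rewrite -(separates_alternating D phi (x0 := a) (size_uchain a) (uchain_sorted aGc)).
- by apply: eq_bigr => i _; rewrite linearZ /= linext_basis.
- by rewrite nth_uchain.
- by rewrite nth_uchain_last rinf_reducible.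
- by move=> j; apply: uchain_irreducible.
- by move=> j e; apply: uchain_next.
Qed.

Lemma Theta_u_comp (s : seq T) v : {subset s <= Gc T} ->
  Theta (kmap_comp (u_comp k s) v) = Theta v.
Proof.
elim: s => [|a s IH] sGc /=; first by rewrite kmap_comp1l.
have [aGc sGc'] : a \in Gc T /\ {subset s <= Gc T}.
  by split=> [|b bs]; apply: sGc; rewrite inE ?eqxx ?bs ?orbT.
by rewrite kmap_compA (Theta_u_elt _ aGc) (IH sGc').
Qed.

Lemma Theta_nonsurj phi :
  ~~ ([set e : T | irreducible e] \subset [set phi x | x : X]) ->
  Theta (kbasis k phi) = 0.
Proof.
move=> /subsetPn [e]; rewrite inE => e_irr ephi; apply: Theta_eq0 => D.
rewrite linext_basis.
have [/separatesP/(_ e e_irr) [[x _ phix] _]|//] := boolP (separates D phi).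
by case/negP: ephi; apply/imsetP; exists x.
Qed.

Lemma Theta_surjective (t : SIrr T k X) :
  t \in lspan (fun t : SIrr T k X => exists phi, t = Theta (kbasis k phi)).
Proof.
have refl e : (e, e) \in op_corr (Irr_le T) by rewrite op_corrE inE /=.
apply: lspan_sub (fund_functor_lspan op_anti t refl) => _ [S ->].
(* [Gamma phi] may be larger than [S], but its rows have the same joins, so both pass the same tests
   and have the same class. *)
pose phi : {ffun X -> T} := [ffun x => \join_(e | (x, e) \in S) val e]%O.
apply: mem_lspan; exists phi; rewrite Theta_kbasis; apply/eqP.
rewrite -subr_eq0 addrC -scaleN1r.
rewrite -(Sclass_linearl (op_corr (Irr_le T)) (kbasis k 1%g)).
apply/eqP/Sclass_eq0 => [|rho beta]; first exact: op_anti.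
rewrite linearP /= !linext_basis (fund_perm_join _ _ (Gamma_join phi)).
by rewrite (fund_perm_join (phi := phi)) ?scaleN1r ?addNr // => x; rewrite ffunE.
Qed.

End Generation.

Theorem theorem4p7 (k : comPzRingType) (d : Order.disp_t)
    (T : finTBLatticeType d) (s : seq T) (X : finType) :
  perm_eq s (enum (Gc T)) ->
  (forall phi : {ffun X -> T},
     kmap_comp (u_comp k s) (kbasis k phi) \in
       lspan (fun v : kfree k {ffun X -> T} =>
         exists2 f : {ffun X -> T},
           [set f x | x : X] \subset Gset T & v = kbasis k f)) /\
  (forall v : SIrr T k X,
     v \in lspan (fun t : SIrr T k X =>
       exists2 phi : {ffun X -> T}, phi \in BX T X & t = Theta (kbasis k phi))).
Proof.
move=> /perm_mem sE.
have sGc : {subset s <= Gc T} by move=> a; rewrite sE mem_enum.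
have avoid phi : kmap_comp (u_comp k s) (kbasis k phi) \in
    lspan (fun v : kfree k {ffun X -> T} =>
      exists2 f : {ffun X -> T}, [set f x | x : X] \subset Gset T & v = kbasis k f).
  apply: lspan_sub (u_comp_avoid k phi sGc) => _ [f fG ->].
  apply: mem_lspan; exists f => //; apply/subsetP => _ /imsetP [x _ ->].
  (* The list [s] enumerates the complement of [Gset], so both alternatives of the invariant say the
     same. *)
  by have := fG x; rewrite sE mem_enum GcE [_ \in ~: _]inE negbK orbb.
split=> // v; apply: lspan_sub (Theta_surjective v) => _ [phi ->].
rewrite -(Theta_u_comp _ sGc); have /asboolP [l [Pl ->]] := avoid phi.
rewrite (linear_sumZ _ _ _ _ (@Theta_linear d T k X)) big_seq.
apply: rpred_sum => -[c w] /Pl [f fG /= ->]; rewrite rpredZ //.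
(* Part (a) gives values in [Gset]; the maps missing an irreducible value contribute zero, and the
   others lie in [BX]. *)
have [Ef|/Theta_nonsurj ->] := boolP
  ([set e : T | irreducible e] \subset [set f x | x : X]).
  by apply: mem_lspan; exists f; rewrite // inE Ef.
exact: rpred0.
Qed.
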